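(* Let $X$ be a finite nonempty set, let $\mathcal E^0$ be a collection of nonempty subsets of $X$, and for each $E\in\mathcal E^0$ let $\mu_E\colon 2^E\to[0,1]$ be a monotone set function with $\mu_E(\emptyset)=0$. Let $\mathfrak U$ be a calibrated representation-preserving integral scheme and define $$G_E^{\mathfrak U}(u):=\mathfrak U_{\mu_E}(u),\qquad u\in[0,1]^E,\ E\in\mathcal E^0.$$ Then $\mathbf G^{\mathfrak U}=\{G_E^{\mathfrak U}:E\in\mathcal E^0\}$ is an FCA on the unit-cube profile class, and it is consistent under zero extension if and only if the family $\{\mu_E:E\in\mathcal E^0\}$ is projectively compatible.
   Context: A set function $\mu\colon2^E\to[0,1]$ is monotone if $\mu(A)\le\mu(B)$ whenever $A\subseteq B\subseteq E$. For $F\subseteq E$ and $u\in[0,1]^F$, $Z_{F,E}u\in[0,1]^E$ equals $u$ on $F$ and $0$ on $E\setminus F$. $\mathbf 1_B$ denotes the indicator of $B\subseteq E$ as an element of $[0,1]^E$; $0_E$ is the zero profile. An integral scheme $\mathfrak U$ assigns to every finite set $E$, every monotone set function $\mu\colon2^E\to[0,1]$ with $\mu(\emptyset)=0$, and every $u\in[0,1]^E$ a value $\mathfrak U_\mu(u)\in[0,1]$. It is calibrated and representation preserving if: (U1) for all $u,v\in[0,1]^E$, $u\le v$ pointwise implies $\mathfrak U_\mu(u)\le\mathfrak U_\mu(v)$, and $\mathfrak U_\mu(0_E)=0$; (U2) $\mathfrak U_\mu(\mathbf 1_B)=\mu(B)$ for every $B\subseteq E$; (U3) whenever $F\subseteq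 E$ and monotone set functions $\lambda\colon2^F\to[0,1]$ and $\mu\colon2^E\to[0,1]$, both vanishing at $\emptyset$, satisfy $\mu|_{2^F}=\lambda$, then $\mathfrak U_\mu(Z_{F,E}u)=\mathfrak U_\lambda(u)$ for all $u\in[0,1]^F$. An FCA on the unit-cube profile class is a family $\{G_E:E\in\mathcal E^0\}$ of functionals $G_E\colon[0,1]^E\to[0,\infty]$, each nondecreasing for the pointwise order with $G_E(0_E)=0$. It is consistent under zero extension if $G_E(Z_{F,E}v)=G_F(v)$ for all $F\subseteq E$ in $\mathcal E^0$ and all $v\in[0,1]^F$. The family $\{\mu_E\}$ is projectively compatible if $\mu_E(B)=\mu_F(B)$ for every $B\subseteq F\subseteq E$ with $F,E\in\mathcal E^0$. *)

(* Defs.v *)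
From HB Require Import structures.
From mathcomp Require Import all_boot all_order all_algebra.
From mathcomp Require Import interval_inference.
From mathcomp Require Import all_reals.

Set Implicit Arguments.
Unset Strict Implicit.
Unset Printing Implicit Defensive.

Import Order.TTheory GRing.Theory Num.Theory.
Local Open Scope ring_scope.

(* A finite set is represented as a subset [E : {set T}] of a finite type [T],
   so that inclusions F \subset E are literal inclusions. Profiles and set
   functions on E are defined on the points, resp. subsets, of E only: they
   carry no information about the rest of [T]. *)

Definition subset_of (T : finType) (E : {set T}) := {B : {set T} | B \subset E}.

Definition empty_sub (T : finType) (E : {set T}) : subset_of E :=
  exist _ set0 (sub0set E).

Definition widen_sub (T : finType) (F E : {set T}) (FE : F \subset E)
    (B : subset_of F) : subset_of E :=
  exist _ (val B) (subset_trans (valP B) FE).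

Definition set_function (R : realType) (T : finType) (E : {set T}) :=
  {ffun subset_of E -> {i01 R}}.

Definition monotone (R : realType) (T : finType) (E : {set T})
    (mu : set_function R E) : Prop :=
  forall A B : subset_of E, val A \subset val B -> mu A <= mu B.

Record capacity (R : realType) (T : finType) (E : {set T}) := Capacity {
  cap_fun :> {ffun subset_of E -> {i01 R}};
  cap_monotone : monotone cap_fun;
  cap_empty : cap_fun (empty_sub E) = 0%:i01
}.

Definition profile (R : realType) (T : finType) (E : {set T}) :=
  {ffun {x : T | x \in E} -> {i01 R}}.

Definition profile_le (R : realType) (T : finType) (E : {set T})
    (u v : profile R E) : Prop :=
  forall x, u x <= v x.

Definition zero_profile (R : realType) (T : finType) (E : {set T}) :
    profile R E :=
  [ffun => 0%:i01].

Definition indicator (R : realType) (T : finType) (E : {set T})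
    (B : subset_of E) : profile R E :=
  [ffun x => if val x \in val B then 1%:i01 else 0%:i01].

Definition zero_ext (R : realType) (T : finType) (F E : {set T})
    (u : profile R F) : profile R E :=
  [ffun x => if insub (val x) is Some y then u y else 0%:i01].

Definition integral_scheme (R : realType) : Type :=
  forall (T : finType) (E : {set T}), capacity R E -> profile R E -> {i01 R}.

Record calibrated_representation_preserving (R : realType)
    (U : integral_scheme R) : Prop := {
  scheme_nondecreasing :
    forall (T : finType) (E : {set T}) (mu : capacity R E) (u v : profile R E),
      profile_le u v -> U T E mu u <= U T E mu v;
  scheme_zero :
    forall (T : finType) (E : {set T}) (mu : capacity R E),
      U T E mu (zero_profile R E) = 0%:i01;
  scheme_calibrated :
    forall (T : finType) (E : {set T}) (mu : capacity R E) (B : subset_of E),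
      U T E mu (indicator R B) = mu B;
  scheme_zero_ext :
    forall (T : finType) (F E : {set T}) (FE : F \subset E)
      (lambda : capacity R F) (mu : capacity R E),
      (forall B : subset_of F, mu (widen_sub FE B) = lambda B) ->
      forall u : profile R F, U T E mu (zero_ext E u) = U T F lambda u
}.

Definition member (X : finType) (E0 : {set {set X}}) :=
  {E : {set X} | E \in E0}.

Definition functional_family (R : realType) (X : finType)
    (E0 : {set {set X}}) : Type :=
  forall E : member E0, profile R (val E) -> \bar R.

Record is_FCA (R : realType) (X : finType) (E0 : {set {set X}})
    (G : functional_family R E0) : Prop := {
  FCA_ge0 :
    forall (E : member E0) (u : profile R (val E)), (0 <= G E u)%E;
  FCA_nondecreasing :
    forall (E : member E0) (u v : profile R (val E)),
      profile_le u v -> (G E u <= G E v)%E;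
  FCA_zero : forall E : member E0, G E (zero_profile R (val E)) = 0%E
}.

Definition consistent_zero_ext (R : realType) (X : finType)
    (E0 : {set {set X}}) (G : functional_family R E0) : Prop :=
  forall F E : member E0, val F \subset val E ->
    forall v : profile R (val F), G E (zero_ext (val E) v) = G F v.

Definition projectively_compatible (R : realType) (X : finType)
    (E0 : {set {set X}}) (mu : forall E : member E0, capacity R (val E)) :
    Prop :=
  forall (F E : member E0) (FE : val F \subset val E) (B : subset_of (val F)),
    mu E (widen_sub FE B) = mu F B.

Definition scheme_family (R : realType) (U : integral_scheme R) (X : finType)
    (E0 : {set {set X}}) (mu : forall E : member E0, capacity R (val E)) :
    functional_family R E0 :=
  fun E u => ((U X (val E) (mu E) u)%:num)%:E%E.

(* Main.v *)
Require Import Defs.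
From mathcomp Require Import all_boot all_order all_algebra.
From mathcomp Require Import interval_inference.
From mathcomp Require Import all_reals.

(** The FCA axioms are inherited from the scheme. Projective compatibility is exactly the hypothesis
    of [scheme_zero_ext], which yields consistency. Conversely, calibration recovers a capacity from
    its values on indicators, and [zero_ext_indicator] lets consistency be tested on them. *)

Lemma zero_ext_indicator (R : realType) (T : finType) (F E : {set T})
    (FE : F \subset E) (B : subset_of F) :
  zero_ext E (indicator R B) = indicator R (widen_sub FE B).
Proof.
apply/ffunP => x; rewrite !ffunE /=.
case: insubP => [y _ yx | xF]; first by rewrite ffunE yx.
(* Outside [F] the extension is 0, and so is the indicator, since [B] lies in [F]. *)
by case: ifP => // xB; rewrite (subsetP (valP B) _ xB) in xF.
Qed.

Theorem theorem6p3 (R : realType) (X : finType) (X_nonempty : (0 < #|X|)%N)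
    (E0 : {set {set X}}) (E0_nonempty : forall E : {set X}, E \in E0 -> E != set0)
    (mu : forall E : member E0, capacity R (val E))
    (U : integral_scheme R) (hU : calibrated_representation_preserving U) :
  is_FCA (scheme_family U mu) /\
  (consistent_zero_ext (scheme_family U mu) <-> projectively_compatible mu).
Proof.
split; first split.
- by move=> E u; rewrite /scheme_family lee_fin.
- move=> E u v uv; rewrite /scheme_family lee_fin num_le.
  exact: scheme_nondecreasing hU _ _ _ _ _ uv.
- by move=> E; rewrite /scheme_family (scheme_zero hU).
split=> [consG F E FE B | compat F E FE v].
- rewrite -!(scheme_calibrated hU) -zero_ext_indicator.
  (* Consistency equates extended reals; injectivity of [%:E] and of the projection from [{i01 R}]
     brings the equality back to the scheme's values. *)
  by have [/val_inj] := consG F E FE (indicator R B).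
- by rewrite /scheme_family (scheme_zero_ext hU (FE := FE) (lambda := mu F)).
Qed.
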